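(* There is an absolute constant $C>0$ such that, for all integers $d,n\ge 1$, all real $0<p\le 1$ and $0<\varepsilon\le 1/2$, and every finite set $U$, every $n$-uniform family $\mathcal F\subseteq 2^U$ with $\mathrm{VC}(\mathcal F)\le d$ and $$|\mathcal F|>\left(\frac{C}{p}\log\frac{d+1}{\varepsilon}\right)^n$$ contains (as a subfamily) a $(p,\varepsilon)$-robust sunflower.
   Context: $\log$ is the natural logarithm. A family is $n$-uniform if all its members have size exactly $n$. $W\sim\mathrm{Bin}(U,p)$ means that each point of the finite set $U$ is included in the random set $W$ independently with probability $p$. VC dimension: a set $D\subseteq U$ is shattered by $\mathcal F$ if $\{S\cap D:S\in\mathcal F\}=2^D$; $\mathrm{VC}(\mathcal F)$ is the largest size of a set shattered by $\mathcal F$. A family $\mathcal R\subseteq 2^U$ with at least two members is a $(p,\varepsilon)$-robust sunflower if, writing $T=\bigcap_{R\in\mathcal R}R$, we have $T\notin\mathcal R$ and $\Pr_W[\exists R\in\mathcal R: R\subseteq T\cup W]\ge 1-\varepsilon$ for $W\sim\mathrm{Bin}(U,p)$. *)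

(* Defs.v *)
From mathcomp Require Import all_boot all_order all_algebra.
From mathcomp Require Import reals exp.

Set Implicit Arguments.
Unset Strict Implicit.
Unset Printing Implicit Defensive.

Import Order.TTheory GRing.Theory Num.Theory.

Local Open Scope ring_scope.

(* The ground set is a whole finite type [U]; families are [{set {set U}}]. *)

Definition uniform (U : finType) (n : nat) (F : {set {set U}}) : Prop :=
  forall S : {set U}, S \in F -> #|S| = n.

Definition shattered (U : finType) (F : {set {set U}}) (D : {set U}) : bool :=
  [set S :&: D | S in F] == powerset D.

(* The empty family shatters nothing, and gets the junk value 0. *)
Definition VC (U : finType) (F : {set {set U}}) : nat :=
  \max_(D : {set U} | shattered F D) #|D|.

(* The probability that Bin(U, p) equals [W]: independent inclusions. *)
Definition bin_mass (R : realType) (U : finType) (p : R) (W : {set U}) : R :=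
  \prod_(x : U) (if x \in W then p else 1 - p).

Definition bin_prob (R : realType) (U : finType) (p : R) (E : pred {set U}) : R :=
  \sum_(W : {set U} | E W) bin_mass p W.

Definition kernel (U : finType) (G : {set {set U}}) : {set U} :=
  \bigcap_(S in G) S.

Definition robust_sunflower (R : realType) (U : finType) (p eps : R)
    (G : {set {set U}}) : Prop :=
  [/\ (2 <= #|G|)%N,
      kernel G \notin G &
      1 - eps <= bin_prob p
        (fun W : {set U} => [exists S in G, S \subset kernel G :|: W])].

(* Main.v *)
Require Import Defs.
From mathcomp Require Import all_boot all_order all_algebra.
From mathcomp Require Import reals sequences exp.
From mathcomp Require Import zify ring lra.

(* Passing to the sets of F through a maximal T of large degree gives, after
   removing T, a lam-spread family L with 1 / lam = (C / p) log ((d + 1) / eps),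
   so it suffices that a p-random W contains a member of L with probability at
   least 1 - eps.

   For X in L let h(X, W) ([defect] below) be the least size of Y \ W over members Y of L inside
   X u W.  Thin W of density q to W' = W n V of density q (1 - rho).  If
   h(X, W) = h(X, W') = s, let T be a minimal fragment for W'; it is also
   minimal for W, so every member of L inside Z = W u T contains T.  Hence T
   lies in the intersection K(Z) ([core] below) of these members, and K(Z) survives the
   thinning.  Given Z, survival has probability about (1 - rho) ^ |K(Z)|, while
   by Sauer-Shelah there are few traces of X on K(Z); the product of the two is
   at most rho ^ (- d) whatever |K(Z)| is.  Together with spreadness this event
   has probability at most rho ^ (- d) (2 lam / (q (1 - rho))) ^ s.  As h = s
   costs only rho = 1 / s ^ 2 of density, and these sum to a constant, h decreases
   one unit at a time from n down to k = O(d ^ 2), independently of n.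

   From there on the usual fragment argument cuts the mean of h by a constant
   factor each time W receives an independent set of density O(lam), so O(log (k / eps)) rounds
   bring the mean of h below eps; and h >= 1 if W contains no member of L. *)

Set Implicit Arguments.
Unset Strict Implicit.
Unset Printing Implicit Defensive.

Import Order.TTheory GRing.Theory Num.Theory.

Local Open Scope ring_scope.

(** * Expectations over binomial random subsets *)

Definition bin_exp (R : realType) (U : finType) (p : R) (f : {set U} -> R) : R :=
  \sum_(W : {set U}) bin_mass p W * f W.

Section Binomial.
Variables (R : realType) (U : finType).
Implicit Types (p q : R) (f g : {set U} -> R) (A B W V T Z : {set U}).

Lemma bin_mass_ge0 p W : 0 <= p <= 1 -> 0 <= bin_mass p W.
Proof.
by move=> /andP[p0 p1]; apply: prodr_ge0 => x _; case: ifP => _ //; rewrite subr_ge0.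
Qed.

Lemma prodrD_set (F G : U -> R) :
  \prod_x (F x + G x) = \sum_(A : {set U}) \prod_x (if x \in A then F x else G x).
Proof. exact: bigA_distr. Qed.

(** Points are independent, so a pointwise Boolean combination of two binomial sets is again
    binomial, with its density computed at a single point. Taking [andb] gives thinning, [orb] gives
    augmentation. *)
Lemma bin_exp_op (o : bool -> bool -> bool) p q f :
  bin_exp p (fun W => bin_exp q (fun V => f [set x | o (x \in W) (x \in V)]))
  = bin_exp (p * (q * (o true true)%:R + (1 - q) * (o true false)%:R)
             + (1 - p) * (q * (o false true)%:R + (1 - q) * (o false false)%:R)) f.
Proof.
set t := (X in bin_exp X f).
have t1 : 1 - t = p * (q * (~~ o true true)%:R + (1 - q) * (~~ o true false)%:R)
             + (1 - p) * (q * (~~ o false true)%:R + (1 - q) * (~~ o false false)%:R).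
  by rewrite /t; case: (o true true); case: (o true false);
     case: (o false true); case: (o false false) => /=; ring.
(* The combined set is named [A] by a product of pointwise indicators; the sums over [W] and [V]
   then factor over the points. *)
transitivity (\sum_(W : {set U}) \sum_(V : {set U}) \sum_(A : {set U})
    (\prod_x ((o (x \in W) (x \in V) == (x \in A))%:R * ((if x \in W then p else 1 - p)
        * (if x \in V then q else 1 - q)))) * f A).
  apply: eq_bigr => W _; rewrite mulr_sumr; apply: eq_bigr => V _; rewrite mulrA.
  rewrite (bigD1 [set x | o (x \in W) (x \in V)]) //= [X in _ = _ + X]big1 ?addr0 => [|A neA].
    congr (_ * _); rewrite /bin_mass -big_split; apply: eq_bigr => x _ /=.
    by rewrite inE eqxx mul1r.
  have [x nx] : exists x, o (x \in W) (x \in V) != (x \in A).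
    apply/existsP; rewrite -negb_forall; apply: contra neA => /forallP h.
    by apply/eqP/setP=> x; rewrite inE (eqP (h x)).
  by rewrite (bigD1 x) //= (negPf nx) !mul0r.
under eq_bigr do rewrite exchange_big; rewrite exchange_big /=.
apply: eq_bigr => A _.
under eq_bigr do rewrite -mulr_suml.
rewrite -mulr_suml; congr (_ * _).
transitivity (\sum_(W : {set U}) \prod_x
   (if x \in W then p * (q * (o true true == (x \in A))%:R + (1 - q) * (o true false == (x \in A))%:R)
    else (1 - p) * (q * (o false true == (x \in A))%:R + (1 - q) * (o false false == (x \in A))%:R))).
  apply: eq_bigr => W _.
  transitivity (\sum_(V : {set U}) \prod_x
     (if x \in V then (o (x \in W) true == (x \in A))%:R * ((if x \in W then p else 1 - p) * q)
      else (o (x \in W) false == (x \in A))%:R * ((if x \in W then p else 1 - p) * (1 - q)))).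
    by apply: eq_bigr => V _; apply: eq_bigr => x _; case: (x \in V).
  rewrite -prodrD_set; apply: eq_bigr => x _.
  by case: (x \in W); ring.
rewrite -prodrD_set; apply: eq_bigr => x _.
case: (x \in A).
  by rewrite /t !eqb_id.
by rewrite t1; case: (o true true); case: (o true false);
     case: (o false true); case: (o false false).
Qed.

Lemma eq_bin_exp p f g : f =1 g -> bin_exp p f = bin_exp p g.
Proof. by move=> e; apply: eq_bigr => W _; rewrite e. Qed.

Lemma bin_expD p f g : bin_exp p (fun W => f W + g W) = bin_exp p f + bin_exp p g.
Proof. by rewrite /bin_exp -big_split; apply: eq_bigr => W _; rewrite mulrDr. Qed.

Lemma bin_expZ p (c : R) f : bin_exp p (fun W => c * f W) = c * bin_exp p f.
Proof. by rewrite /bin_exp mulr_sumr; apply: eq_bigr => W _; rewrite mulrCA. Qed.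

Lemma bin_exp_sum p (I : Type) (r : seq I) (P : pred I) (F : I -> {set U} -> R) :
  bin_exp p (fun W => \sum_(i <- r | P i) F i W) = \sum_(i <- r | P i) bin_exp p (F i).
Proof.
by rewrite /bin_exp exchange_big; apply: eq_bigr => W _; rewrite mulr_sumr.
Qed.

Lemma bin_exp_thin p q f :
  bin_exp p (fun W => bin_exp q (fun V => f (W :&: V))) = bin_exp (p * q) f.
Proof.
have := bin_exp_op andb p q f; rewrite /= !(mulr1, mulr0, addr0) => <-.
apply: eq_bin_exp => W; apply: eq_bin_exp => V.
by congr f; apply/setP=> x; rewrite !inE.
Qed.

Lemma bin_exp_augment p q f :
  bin_exp p (fun W => bin_exp q (fun V => f (W :|: V))) = bin_exp (p + q - p * q) f.
Proof.
have := bin_exp_op orb p q f; rewrite /= !(mulr1, mulr0, addr0).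
rewrite (_ : p * _ + _ = p + q - p * q); last by ring.
move=> <-; apply: eq_bin_exp => W; apply: eq_bin_exp => V.
by congr f; apply/setP=> x; rewrite !inE.
Qed.

Lemma sum_bin_mass p : \sum_(W : {set U}) bin_mass p W = 1.
Proof.
rewrite /bin_mass -(prodrD_set (fun _ => p) (fun _ => 1 - p)) big1 // => x _; ring.
Qed.

Lemma le_bin_exp p f g :
  0 <= p <= 1 -> (forall W, f W <= g W) -> bin_exp p f <= bin_exp p g.
Proof.
by move=> hp h; apply: ler_sum => W _; apply: ler_wpM2l; rewrite ?bin_mass_ge0.
Qed.

Lemma bin_exp_const p (c : R) : bin_exp p (fun _ : {set U} => c) = c.
Proof. by rewrite /bin_exp -mulr_suml sum_bin_mass mul1r. Qed.

(** A set of density [q] is a thinning by [q / p] of one of density [p], and thinning can only raise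
    [f]. *)
Lemma bin_exp_antimono p q f : 0 <= q <= p -> 0 < p -> p <= 1 ->
  (forall W V, V \subset W -> f W <= f V) -> bin_exp p f <= bin_exp q f.
Proof.
move=> /andP[q0 qp] p0 p1 hf.
have p01 : 0 <= p <= 1 by lra.
have qp01 : 0 <= q / p <= 1 by rewrite ler_pdivrMr // mul1r qp andbT divr_ge0 // ltW.
have -> : bin_exp q f = bin_exp (p * (q / p)) f by congr bin_exp; field; lra.
rewrite -bin_exp_thin; apply: le_bin_exp => // W.
rewrite -[leLHS](bin_exp_const (q / p)); apply: le_bin_exp => // V.
by rewrite hf // subsetIl.
Qed.

Lemma bin_prob_sub p B : bin_prob p (fun W => B \subset W) = p ^+ #|B|.
Proof.
rewrite /bin_prob /bin_mass big_mkcond /=.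
transitivity (\sum_(W : {set U}) \prod_x (if x \in W then p else if x \in B then 0 else 1 - p)).
  apply: eq_bigr => W _; case: ifPn => [/subsetP sBW | /subsetPn[x xB xW]].
    apply: eq_bigr => x _; case: ifPn => // xW.
    by case: ifPn => // /sBW; rewrite (negPf xW).
  by rewrite (bigD1 x) //= (negPf xW) xB mul0r.
rewrite -prodrD_set -prodr_const [RHS]big_mkcond; apply: eq_bigr => x _.
by case: ifP => _ //=; ring.
Qed.

(** At a point of [T] the left side has the factor [(1 - p) * p] and the right side [p]; elsewhere
    the factors agree. *)
Lemma bin_mass_setU p W T : 0 <= p <= 1 -> [disjoint W & T] ->
  bin_mass p W * p ^+ #|T| <= bin_mass p (W :|: T).
Proof.
move=> /andP[p0 p1] dWT; rewrite -prodr_const big_mkcond /bin_mass -big_split /=.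
apply: ler_prod => x _; rewrite !inE.
case: (boolP (x \in W)) => xW /=; first by rewrite (disjointFr dWT xW) mulr1 p0 lexx.
case: (x \in T); last by rewrite mulr1 lexx subr_ge0 p1.
by rewrite mulr_ge0 ?subr_ge0 //= ler_piMl //; lra.
Qed.

Lemma sum_powerset_bin q A :
  \sum_(D in powerset A) q ^+ #|D| * (1 - q) ^+ (#|A| - #|D|) = 1.
Proof.
have e : forall x, (if x \in A then q else 0) + (if x \in A then 1 - q else 1) = 1 :> R.
  by move=> x; case: ifP => _; ring.
have : \prod_x ((if x \in A then q else 0) + (if x \in A then 1 - q else 1)) = 1 :> R.
  by rewrite big1.
rewrite prodrD_set => e1; rewrite -[RHS]e1 [LHS]big_mkcond; apply: eq_bigr => D _.
rewrite powersetE; case: ifPn => [sDA | /subsetPn[x xD xA]]; last first.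
  by rewrite (bigD1 x) //= xD (negPf xA) mul0r.
rewrite (bigID (mem D)) /=; congr (_ * _).
  rewrite -prodr_const; apply: eq_bigr => x xD.
  by rewrite xD (subsetP sDA).
rewrite (_ : (#|A| - #|D|)%N = #|A :\: D|); last by rewrite cardsD (setIidPr sDA).
rewrite -prodr_const [LHS]big_mkcond [RHS]big_mkcond.
by apply: eq_bigr => x _; rewrite inE; case: (x \in D); case: (x \in A).
Qed.

End Binomial.

(** * The Sauer-Shelah inequality and traces *)

Section SauerShelah.
Variable U : finType.
Implicit Types (F G : {set {set U}}) (A D K S : {set U}).

Lemma shatteredP F D :
  reflect (forall B : {set U}, B \subset D -> exists2 S, S \in F & S :&: D = B) (shattered F D).
Proof.
apply: (iffP eqP) => [e B sBD | h].
  have : B \in [set S :&: D | S in F] by rewrite e powersetE.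
  by case/imsetP=> S SF ->; exists S.
apply/setP=> B; rewrite powersetE; apply/imsetP/idP => [[S _ ->]|/h[S SF <-]].
  exact: subsetIr.
by exists S.
Qed.

(** Pajor's form of Sauer-Shelah, by deleting a point [x]: [F] splits into the members avoiding [x]
    and those containing it, with [x] removed. Sets shattered by either half are shattered by [F],
    and a set [D] shattered by both yields the additional shattered set [x |: D]. *)
Lemma card_le_shattered F : (#|F| <= #|[set D | shattered F D]|)%N.
Proof.
suff H : forall m K F, #|K| = m -> F \subset powerset K ->
    (#|F| <= #|[set D | shattered F D]|)%N.
  by apply: (H _ [set: U] _ erefl); apply/subsetP=> S _; rewrite powersetE subsetT.
elim=> [|m IH] {F} K F.
  move/eqP; rewrite cards_eq0 => /eqP -> sF.
  have [->|[S SF]] := set_0Vmem F; first by rewrite cards0.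
  have S0 : S = set0 by apply/eqP; rewrite -subset0 -powersetE (subsetP sF).
  apply: leq_trans (_ : #|[set set0 : {set U}]| <= _)%N.
    by apply: subset_leq_card; rewrite -powerset0.
  apply: subset_leq_card; rewrite sub1set inE; apply/shatteredP=> B.
  by rewrite subset0 => /eqP ->; exists S; rewrite // setI0.
move=> cK sF.
have [x xK] : exists x, x \in K by apply/set0Pn; rewrite -cards_eq0 cK.
pose F0 := [set S in F | x \notin S].
pose F1 := [set S :\ x | S in [set S in F | x \in S]].
have cF : #|F| = (#|F0| + #|F1|)%N.
  rewrite [#|F1|]card_in_imset; last first.
    move=> S T; rewrite !inE => /andP[_ xS] /andP[_ xT] e.
    by rewrite -(setD1K xS) -(setD1K xT) e.
  rewrite -cardsUI (_ : _ :&: _ = set0) ?cards0 ?addn0.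
    by congr #|pred_of_set _|; apply/setP=> S; rewrite !inE; case: (x \in S); rewrite ?andbT ?andbF ?orbF.
  by apply/setP=> S; rewrite !inE; case: (x \in S); rewrite ?andbF.
have cKx : #|K :\ x| = m by move: cK; rewrite (cardsD1 x) xK => -[].
have sF0 : F0 \subset powerset (K :\ x).
  apply/subsetP=> S; rewrite inE powersetE => /andP[SF xS].
  by rewrite subsetD1 xS andbT -powersetE (subsetP sF).
have sF1 : F1 \subset powerset (K :\ x).
  apply/subsetP=> _ /imsetP[S + ->]; rewrite !inE => /andP[SF xS].
  by apply: setSD; rewrite -powersetE (subsetP sF).
have sh0 D : shattered F0 D -> shattered F D.
  move/shatteredP=> h; apply/shatteredP=> B /h[S]; rewrite inE => /andP[SF _] e.
  by exists S.
have notx G D : G \subset powerset (K :\ x) -> shattered G D -> x \notin D.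
  move=> sG /shatteredP /(_ D (subxx _))[S /(subsetP sG) + e].
  rewrite powersetE subsetD1 => /andP[_ xS]; apply: contra xS => xD.
  by move: xD; rewrite -e inE => /andP[].
have sh1 D : shattered F1 D -> shattered F D.
  move=> h; have xD := notx _ _ sF1 h; move/shatteredP: h => h.
  apply/shatteredP=> B /h[_ /imsetP[S + ->] <-]; rewrite !inE => /andP[SF xS].
  exists S => //; apply/setP=> y; rewrite !inE; case: eqP => [->|//].
  by rewrite (negPf xD) !andbF.
pose both := [set D | shattered F0 D] :&: [set D | shattered F1 D].
pose any := [set D | shattered F0 D] :|: [set D | shattered F1 D].
have any_notx D : D \in any -> x \notin D.
  by rewrite !inE => /orP[]; apply: notx.
rewrite cF; apply: leq_trans (leq_add (IH _ _ cKx sF0) (IH _ _ cKx sF1)) _.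
rewrite -cardsUI -/both -/any.
have -> : #|both| = #|[set x |: D | D in both]|.
  rewrite card_in_imset // => D E DB EB e.
  have xD : x \notin D by apply: any_notx; move: DB; rewrite !inE => /andP[->].
  have xE : x \notin E by apply: any_notx; move: EB; rewrite !inE => /andP[->].
  by rewrite -(setU1K xD) -(setU1K xE) e.
rewrite -cardsUI (_ : any :&: _ = set0) ?cards0 ?addn0.
  apply: subset_leq_card; apply/subsetP=> D; rewrite in_setU => /orP[].
    by rewrite !inE => /orP[/sh0|/sh1].
  case/imsetP=> E EB ->; have xE : x \notin E.
    by apply: any_notx; move: EB; rewrite !inE => /andP[->].
  move: EB; rewrite !inE => /andP[/shatteredP h0 /shatteredP h1].
  apply/shatteredP=> B sB.
  have sBE : B :\ x \subset E by rewrite subDset.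
  case: (boolP (x \in B)) => xB.
    have [_ /imsetP[S + ->] e] := h1 _ sBE; rewrite inE => /andP[SF xS].
    exists S => //; rewrite -(setD1K xB) -e; apply/setP=> y; rewrite !inE.
    by case: eqP => [->|//]; rewrite xS.
  have [S + e] := h0 _ sBE; rewrite inE => /andP[SF xS].
  exists S => //; move: e; have -> : B :\ x = B.
    by apply/setP=> y; rewrite !inE; case: eqP => [->|//]; rewrite (negPf xB).
  move=> <-; apply/setP=> y; rewrite !inE.
  by case: eqP => [->|//]; rewrite (negPf xS).
apply/setP=> D; rewrite !in_set0 in_setI; apply/negP=> /andP[/any_notx xD /imsetP[E _ e]].
by move: xD; rewrite e !inE eqxx.
Qed.

End SauerShelah.

Definition traces (U : finType) (F : {set {set U}}) (K : {set U}) :=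
  [set S :&: K | S in F].

(** There are at least as many sets shattered by the traces as traces. Each lies in [K], has at most
    [d] points, and so has mass at least [rho ^+ d * (1 - rho) ^+ #|K|] as a [rho]-random subset of
    [K]; the masses of all subsets of [K] sum to 1. *)
Lemma card_traces_bin (R : realType) (U : finType) (F : {set {set U}})
    (K : {set U}) (d : nat) (rho : R) :
  0 <= rho <= 1 -> (forall D : {set U}, shattered F D -> (#|D| <= d)%N) ->
  rho ^+ d * #|traces F K|%:R * (1 - rho) ^+ #|K| <= 1.
Proof.
move=> /andP[r0 r1] hd.
have sub D : shattered (traces F K) D -> (D \subset K) && (#|D| <= d)%N.
  move/shatteredP=> h.
  have sDK : D \subset K.
    have [_ /imsetP[S _ ->] e] := h _ (subxx D).
    by rewrite -e -setIA subIset // subIset ?subxx // orbT.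
  rewrite sDK; apply: hd; apply/shatteredP=> B /h[_ /imsetP[S SF ->] <-].
  by exists S; rewrite // -setIA (setIidPr sDK).
rewrite -[leRHS](sum_powerset_bin rho K).
apply: le_trans (_ : \sum_(D in powerset K | shattered (traces F K) D)
   rho ^+ d * (1 - rho) ^+ #|K| <= _).
  rewrite sumr_const -[leRHS]mulr_natr [leLHS]mulrAC.
  apply: ler_wpM2l; first by rewrite mulr_ge0 // exprn_ge0 // subr_ge0.
  rewrite ler_nat; apply: leq_trans (card_le_shattered _) _.
  apply: subset_leq_card; apply/subsetP=> D; rewrite !inE => h.
  by rewrite unfold_in /= h andbT powersetE; case/andP: (sub _ h).
rewrite [leLHS]big_mkcondr /=; apply: ler_sum => D; rewrite powersetE => sDK.
case: ifP => [/sub /andP[_ cD]|_]; last by rewrite mulr_ge0 // exprn_ge0 // subr_ge0.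
apply: ler_pM; rewrite ?exprn_ge0 ?subr_ge0 //.
  by apply: ler_wiXn2l.
by apply: ler_wiXn2l; rewrite ?subr_ge0 ?leq_subr //; lra.
Qed.

(** * Defects, fragments and spread families *)

Definition best (U : finType) (L : {set {set U}}) (X W : {set U}) : {set U} :=
  [arg min_(Y < X | (Y \in L) && (Y \subset X :|: W)) #|Y :\: W|].

Definition defect (U : finType) (L : {set {set U}}) (X W : {set U}) : nat :=
  #|best L X W :\: W|.

(** If no member of [L] lies in [Z], the inner intersection is all of [U] and the value is [Z]. *)
Definition core (U : finType) (L : {set {set U}}) (Z : {set U}) : {set U} :=
  Z :&: \bigcap_(Y in L | Y \subset Z) Y.

Definition spread (R : realType) (U : finType) (lam : R) (L : {set {set U}}) :=
  forall T : {set U}, #|[set X in L | T \subset X]|%:R <= #|L|%:R * lam ^+ #|T|.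

Section Fragments.
Variables (R : realType) (U : finType) (L : {set {set U}}).
Implicit Types (X Y W V T Z K S : {set U}).

Lemma bestP X W : X \in L ->
  [/\ best L X W \in L, best L X W \subset X :|: W &
      forall Y, Y \in L -> Y \subset X :|: W -> (defect L X W <= #|Y :\: W|)%N].
Proof.
move=> XL; rewrite /defect /best.
case: arg_minnP => [|Y /andP[YL sY] minY]; first by rewrite XL subsetUl.
by split=> // Z ZL sZ; apply: minY; rewrite ZL.
Qed.

Lemma defect_le_card X W : X \in L -> (defect L X W <= #|X|)%N.
Proof.
move=> XL; have [_ _ h] := bestP W XL.
by apply: leq_trans (h X XL (subsetUl _ _)) _; rewrite subset_leq_card ?subsetDl.
Qed.

Lemma defect_anti X W V : X \in L -> V \subset W -> (defect L X W <= defect L X V)%N.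
Proof.
move=> XL sVW; have [_ _ h] := bestP W XL; have [bL sb _] := bestP V XL.
apply: leq_trans (h _ bL _) _; first by apply: subset_trans sb _; apply: setUS.
by rewrite subset_leq_card // setDS.
Qed.

Lemma defect0 X W Y : X \in L -> Y \in L -> Y \subset W -> defect L X W = 0%N.
Proof.
move=> XL YL sYW; have [_ _ h] := bestP W XL.
have /eqP YW : Y :\: W == set0 by rewrite setD_eq0.
apply/eqP; rewrite -leqn0 -(cards0 U) -YW h //.
exact: subset_trans sYW (subsetUr _ _).
Qed.

Lemma defect_gt0 X W : X \in L -> (forall Y, Y \in L -> ~~ (Y \subset W)) ->
  (0 < defect L X W)%N.
Proof.
move=> XL h; have [bL _ _] := bestP W XL.
by rewrite /defect card_gt0 setD_eq0 h.
Qed.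

(** Adding [T] maps the sets disjoint from [T] bijectively onto those containing [T]. *)
Lemma sum_disjoint_setU (g : {set U} -> R) T : (forall Z, 0 <= g Z) ->
  \sum_(W : {set U} | [disjoint W & T]) g (W :|: T) <= \sum_(Z : {set U}) g Z.
Proof.
move=> g0; apply: (@le_trans _ _ (\sum_(Z : {set U} | T \subset Z) g Z)); last first.
  by rewrite [leRHS](bigID (fun Z => T \subset Z)) /= lerDl sumr_ge0.
rewrite [leRHS](reindex_onto (fun W => W :|: T) (fun Z => Z :\: T)) /=; last first.
  move=> Z sTZ; apply/setP=> x; rewrite !inE.
  by case: (boolP (x \in T)) => [/(subsetP sTZ)->|]; rewrite ?orbF.
rewrite le_eqVlt; apply/orP; left; apply/eqP; apply: eq_bigl => W.
rewrite subsetUr /= setDUl setDv setU0.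
by apply/setDidPl/eqP.
Qed.

(* Summing over the pairs [(W, T)] is summing over [Z = W :|: T] together with
   a subset of [K Z]: undoing the addition of [T] costs [q ^+ #|T|]. *)
Lemma fragment_sum (K : {set U} -> {set U}) (w : {set U} -> R) (q : R) (s : nat) :
  0 < q <= 1 -> (forall Z, 0 <= w Z) ->
  \sum_(X in L) bin_exp q (fun W => \sum_(T : {set U} |
     [&& #|T| == s, T \subset X, [disjoint W & T] & T \subset K (W :|: T)]) w (W :|: T))
  <= q ^- s * bin_exp q (fun Z => w Z *
     \sum_(T : {set U} | (T \subset K Z) && (#|T| == s)) #|[set X in L | T \subset X]|%:R).
Proof.
move=> /andP[q0 q1] w0; have q01 : 0 <= q <= 1 by rewrite ltW.
pose c X T Z := ((#|T| == s) && (T \subset X) && (T \subset K Z))%:R * w Z.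
have c0 X T Z : 0 <= c X T Z by rewrite mulr_ge0 ?ler0n.
apply: (@le_trans _ _ (\sum_(X in L) \sum_(T : {set U} | #|T| == s)
   \sum_(Z : {set U}) q ^- s * (bin_mass q Z * c X T Z))).
  apply: ler_sum => X XL; rewrite /bin_exp.
  under eq_bigr do rewrite big_distrr /=.
  rewrite (exchange_big_dep (fun T : {set U} => #|T| == s)) /=; last by move=> W T _ /and4P[].
  apply: ler_sum => T /eqP cT.
  apply: le_trans (@sum_disjoint_setU (fun Z => q ^- s * (bin_mass q Z * c X T Z)) T _); last first.
    by move=> Z; rewrite mulr_ge0 ?invr_ge0 ?exprn_ge0 ?(ltW q0) // mulr_ge0 // bin_mass_ge0.
  rewrite [leLHS]big_mkcond [leRHS]big_mkcond; apply: ler_sum => W _ /=.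
  rewrite cT eqxx /=; case: (boolP [disjoint W & T]) => dWT; last by rewrite andbF.
  rewrite /c cT eqxx /=; case: (T \subset X) => /=; last by rewrite mul0r !mulr0.
  case: (T \subset K _) => /=; last by rewrite mul0r !mulr0.
  rewrite mul1r mulrA ler_wpM2r // ler_pdivlMl ?exprn_gt0 //.
  by rewrite mulrC -cT bin_mass_setU.
rewrite le_eqVlt; apply/orP; left; apply/eqP.
rewrite exchange_big /=; under eq_bigr do rewrite exchange_big /=.
rewrite exchange_big /= /bin_exp big_distrr /=; apply: eq_bigr => Z _.
rewrite mulrA mulr_sumr mulr_sumr [LHS]big_mkcond [RHS]big_mkcond; apply: eq_bigr => T _ /=.
case: (boolP (#|T| == s)) => cT; last by rewrite andbF.
case: (boolP (T \subset K Z)) => sT; last first.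
  by rewrite big1 // => X _; rewrite /c (negPf sT) andbF mul0r !mulr0.
rewrite -sum1_card natr_sum !mulr_sumr.
rewrite [RHS](eq_bigl (fun X => (X \in L) && (T \subset X))) => [|X]; last by rewrite inE.
rewrite [RHS]big_mkcondr /=; apply: eq_bigr => X _.
by rewrite /c cT sT andbT /=; case: (T \subset X); rewrite /= ?mul1r ?mulr1 ?mul0r ?mulr0 // mulrA.
Qed.

(** The pairs of [X] and [T] are grouped by the trace [A = X :&: K]: there are at most [2 ^ #|A|]
    sets [T] for each [X], and by spreadness at most [#|L| * lam ^ #|A|] sets [X]. As
    [2 * lam <= 1], the worst case is [#|A| = s]. *)
Lemma sum_degree_traces (lam : R) K (s : nat) : 0 <= lam -> 2 * lam <= 1 -> spread lam L ->
  \sum_(T : {set U} | (T \subset K) && (#|T| == s)) #|[set X in L | T \subset X]|%:R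
  <= #|L|%:R * #|traces L K|%:R * (2 * lam) ^+ s.
Proof.
move=> l0 l1 hL.
apply: (@le_trans _ _ (\sum_(X in L | (s <= #|X :&: K|)%N) 2 ^+ #|X :&: K|)).
  under eq_bigr => T _ do rewrite -sum1_card natr_sum.
  rewrite (exchange_big_dep (mem L)) /=; last by move=> T X _; rewrite inE => /andP[].
  rewrite [leRHS]big_mkcondr /=; apply: ler_sum => X XL.
  rewrite -natr_sum sum1_card.
  set B := (X in #|X|).
  have BE T : (T \in B) = [&& T \subset K, #|T| == s & T \subset X].
    by rewrite -[T \in B]/(B T) /B inE XL /= andbA.
  have sB : B \subset powerset (X :&: K).
    by apply/subsetP=> T; rewrite BE powersetE subsetI => /and3P[-> _ ->].
  case: ifPn => [_|hs]; first by rewrite -natrX ler_nat -card_powerset subset_leq_card.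
  rewrite [#|B|](_ : _ = 0%N) //; apply/eqP; rewrite -leqn0 leqNgt; apply: contra hs.
  case/card_gt0P=> T TB; have := subsetP sB _ TB; rewrite powersetE => /subset_leq_card.
  by move: TB; rewrite BE => /and3P[_ /eqP -> _].
rewrite (partition_big (fun X => X :&: K) (mem (traces L K))) /=; last first.
  by move=> X /andP[XL _]; apply: imset_f.
rewrite mulrAC [leRHS]mulr_natr -[leRHS]sumr_const; apply: ler_sum => A _.
case: (leqP s #|A|) => hs; last first.
  rewrite big_pred0 ?mulr_ge0 ?exprn_ge0 ?mulr_ge0 ?ler0n // => X.
  by apply/negbTE; apply: contraL hs => /andP[/andP[_ ?] /eqP <-]; rewrite -leqNgt.
apply: (@le_trans _ _ (#|L|%:R * (2 * lam) ^+ #|A|)); last first.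
  by rewrite ler_wpM2l ?ler0n // ler_wiXn2l ?mulr_ge0.
rewrite exprMn mulrCA.
apply: le_trans (ler_wpM2l _ (hL A)); last by rewrite exprn_ge0.
rewrite [leRHS]mulr_natr -[leRHS]sumr_const.
rewrite [leLHS]big_mkcond [leRHS]big_mkcond /=; apply: ler_sum => X _.
rewrite inE; case: (boolP (X \in L)) => //= XL.
case: ifP => [/andP[_ /eqP <-]|_]; first by rewrite subsetIl.
by case: ifP => // _; rewrite exprn_ge0.
Qed.

(** [T] is [B :\: W] for the best [B] at [W :&: V]. Equal defects make [B :\: W] and
    [B :\: (W :&: V)] coincide, so [B :&: W] lies in [V]. A member inside [W :|: T] lies in
    [X :|: W], so by minimality its part outside [W] is all of [T]; hence the core lies between [T]
    and [B]. *)
Lemma stable_defect_fragment X W V :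
  X \in L -> defect L X W = defect L X (W :&: V) ->
  exists T, [/\ #|T| = defect L X W, T \subset X, [disjoint W & T],
    T \subset core L (W :|: T) & core L (W :|: T) :\: T \subset V].
Proof.
move=> XL e; have [bL sb _] := bestP (W :&: V) XL; have [_ _ minW] := bestP W XL.
set B := best L X (W :&: V) in bL sb.
have sBXW : B \subset X :|: W by apply: subset_trans sb _; rewrite setUS // subsetIl.
have eT : B :\: W = B :\: (W :&: V).
  apply/eqP; rewrite eqEcard setDS ?subsetIl //=.
  by apply: leq_trans (minW _ bL sBXW); rewrite e.
pose T := B :\: W.
have sBWT : B \subset W :|: T by rewrite -subDset.
have sTX : T \subset X by rewrite subDset setUC.
have cT : #|T| = defect L X W by rewrite e /T eT.
have coreB : core L (W :|: T) \subset B.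
  apply/subsetP=> x; rewrite inE => /andP[_ /bigcapP]; apply.
  by rewrite bL.
exists T; split=> //.
- by rewrite disjoint_sym -setI_eq0 /T setIDAC setDIl setDv setI0.
- rewrite /core subsetI subsetUr; apply/bigcapsP => Y /andP[YL sY].
  have sYT : Y :\: W \subset T by rewrite subDset.
  suff <- : Y :\: W = T by apply: subsetDl.
  apply/eqP; rewrite eqEcard sYT /= cT minW //.
  by apply: subset_trans sY _; rewrite setUC setSU.
- apply/subsetP=> x /setDP[xc]; have xB := subsetP coreB _ xc.
  rewrite /T eT inE xB andbT negbK; by rewrite inE => /andP[].
Qed.

(** A stable pair gives a fragment [T] such that [V] contains the rest of the core of [Z = W :|: T].
    Averaging over [V] first turns this into a weight depending on [Z] only, so that [fragment_sum]
    applies. *)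
Lemma stable_defect_prob (lam q rho : R) (d s : nat) :
  0 <= lam -> 2 * lam <= 1 -> spread lam L ->
  (forall D : {set U}, shattered L D -> (#|D| <= d)%N) ->
  0 < q <= 1 -> 0 < rho < 1 ->
  \sum_(X in L) bin_exp q (fun W => bin_exp (1 - rho) (fun V =>
     ((defect L X W == s) && (defect L X (W :&: V) == s))%:R))
  <= #|L|%:R * (2 * lam / (q * (1 - rho))) ^+ s / rho ^+ d.
Proof.
move=> l0 l1 hL hd q01 /andP[r0 r1].
have q01' : 0 <= q <= 1 by case/andP: q01 => /ltW -> ->.
have r01 : 0 <= 1 - rho <= 1 by lra.
have s0 : 0 < 1 - rho by lra.
pose w Z := (1 - rho) ^+ (#|core L Z| - s).
have w0 Z : 0 <= w Z by rewrite exprn_ge0 ?(ltW s0).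
apply: le_trans (_ : \sum_(X in L) bin_exp q (fun W => \sum_(T : {set U} |
     [&& #|T| == s, T \subset X, [disjoint W & T] & T \subset core L (W :|: T)])
       w (W :|: T)) <= _).
  apply: ler_sum => X XL; apply: le_bin_exp => // W.
  apply: (@le_trans _ _ (\sum_(T : {set U} |
     [&& #|T| == s, T \subset X, [disjoint W & T] & T \subset core L (W :|: T)])
       bin_prob (1 - rho) (fun V => core L (W :|: T) :\: T \subset V))).
    rewrite /bin_prob; under eq_bigr => T _ do rewrite big_mkcond /=.
    rewrite exchange_big /=; apply: ler_sum => V _.
    case: andP => [[/eqP e1 /eqP e2]|_]; last first.
      by rewrite mulr0; apply: sumr_ge0 => T _; case: ifP; rewrite ?bin_mass_ge0.
    have [T [cT sTX dT sT sV]] := stable_defect_fragment XL (etrans e1 (esym e2)).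
    rewrite (bigD1 T) /=; last by rewrite cT e1 eqxx sTX dT sT.
    rewrite sV mulr1 lerDl sumr_ge0 // => T' _.
    by case: ifP; rewrite ?bin_mass_ge0.
  apply: ler_sum => T /and4P[/eqP cT _ _ sT].
  by rewrite bin_prob_sub cardsD (setIidPr sT) cT.
apply: le_trans (fragment_sum _ s q01 w0) _.
have -> : #|L|%:R * (2 * lam / (q * (1 - rho))) ^+ s / rho ^+ d
   = q ^- s * (#|L|%:R * (2 * lam) ^+ s / (1 - rho) ^+ s / rho ^+ d).
  rewrite !exprMn exprVn exprMn; field.
  by rewrite !expf_neq0 //; lra.
rewrite ler_wpM2l ?invr_ge0 ?exprn_ge0 //; first by case/andP: q01'.
set c := (X in _ <= X).
rewrite -(@bin_exp_const R U q c); apply: le_bin_exp => // Z.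
(* For a core with fewer than [s] points no [T] fits; otherwise the truncated exponent in [w] is a
   true difference. *)
case: (leqP s #|core L Z|) => hs; last first.
  rewrite big_pred0 ?mulr0 => [|T].
    by rewrite /c !mulr_ge0 ?ler0n ?invr_ge0 ?exprn_ge0 ?mulr_ge0 ?(ltW s0) ?(ltW r0).
  apply/negbTE; apply: contraL hs => /andP[/subset_leq_card h /eqP <-].
  by rewrite -leqNgt.
apply: le_trans (ler_wpM2l (w0 Z) (sum_degree_traces _ s l0 l1 hL)) _.
have -> : w Z = (1 - rho) ^+ #|core L Z| / (1 - rho) ^+ s.
  by rewrite /w expfB_cond // (negPf (lt0r_neq0 s0)).
(* The number of traces may grow with the core, but the survival factor compensates for it
   uniformly. *)
have tr := card_traces_bin (core L Z) (_ : 0 <= rho <= 1) hd.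
have {}tr : #|traces L (core L Z)|%:R * (1 - rho) ^+ #|core L Z| <= (rho ^+ d)^-1.
  rewrite -[leRHS]mul1r ler_pdivlMr ?exprn_gt0 // mulrC mulrA; apply: tr; lra.
have mix (a b u e t : R) : u * e * (a * t * b) = a * b * e * (t * u) by ring.
rewrite mix ler_wpM2l // !mulr_ge0 ?ler0n ?invr_ge0 ?exprn_ge0 ?mulr_ge0 //.
exact: ltW.
Qed.

End Fragments.

(** * Numerical estimates *)

Lemma le_geometric_sum (R : realType) (x : R) (j n : nat) : 0 <= x <= 1 / 2 ->
  \sum_(j <= s < n) x ^+ s <= 2 * x ^+ j.
Proof.
move=> /andP[x0 x1].
have [nj|/ltnW jn] := leqP n j; first by rewrite big_geq // mulr_ge0 // exprn_ge0.
rewrite -(subnKC jn); set m := (n - j)%N.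
suff : \sum_(j <= s < j + m) x ^+ s <= 2 * x ^+ j - 2 * x ^+ (j + m).
  by move=> h; apply: le_trans h _; rewrite lerBlDr lerDl mulr_ge0 // exprn_ge0.
elim: m => [|m IH]; first by rewrite addn0 big_geq // subrr.
rewrite addnS big_nat_recr ?leq_addr //= exprS.
have : 0 <= x ^+ (j + m) by rewrite exprn_ge0.
move: (x ^+ (j + m)) IH => y IH y0; nra.
Qed.

(** Write [m = q * e + r] with [e = 2 * d]. Then [q >= e + 6], so
    [m < (q + 1) * e <= q * q <= 2 ^ q], and [m ^ e] is at most [2 ^ (q * e)]. This fixes the level
    [k] down to which the thinning argument works. *)
Lemma expn_le_exp2 (d m : nat) : (0 < d)%N -> (2 * d * (2 * d + 6) <= m)%N ->
  (m ^ (2 * d) <= 2 ^ m)%N.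
Proof.
move=> d0 hm; have e0 : (0 < 2 * d)%N by lia.
set e := (2 * d)%N in hm e0 *; clearbody e.
have sq q : (4 <= q)%N -> (q * q <= 2 ^ q)%N.
  elim: q => // q IH; rewrite leq_eqVlt => /orP[/eqP <- //|]; rewrite ltnS => h.
  by have := IH h; rewrite expnS; nia.
have := divn_eq m e; have := ltn_pmod m e0.
have : (e + 6 <= m %/ e)%N by rewrite leq_divRL // mulnC.
move: (m %/ e)%N (m %% e)%N => q r hq hr mE.
have mq : (m <= 2 ^ q)%N by apply: leq_trans (sq q _); nia.
apply: (@leq_trans ((2 ^ q) ^ e)); first by rewrite leq_exp2r.
by rewrite -expnM leq_exp2l // mE leq_addr.
Qed.

(** * Bounding the mean defect by thinning *)

Section Chain.
Variables (R : realType) (U : finType) (L : {set {set U}}) (lam : R) (d n : nat).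
Hypothesis lam0 : 0 <= lam.
Hypothesis L_spread : spread lam L.
Hypothesis L_shattered : forall D : {set U}, shattered L D -> (#|D| <= d)%N.
Hypothesis L_card : forall X : {set U}, X \in L -> (#|X| <= n)%N.

(** Subtraction of naturals truncates, so only the part of the defect above [j] is counted. *)
Definition excess (j : nat) (q : R) : R :=
  \sum_(X in L) bin_exp q (fun W => (defect L X W - j)%:R).

(** Thinning never lowers the defect. Where it raises it, the increase of [j] by one is paid for;
    where the defect keeps a value [s > j], one unit is missing and is charged to the stable event
    for [s]. These events sum to a geometric series. *)
Lemma excess_step (q rho x : R) (j : nat) :
  0 < q <= 1 -> 0 < rho < 1 -> 2 * lam <= 1 ->
  2 * lam / (q * (1 - rho)) <= x -> x <= 1 / 2 ->
  excess j q <= excess j.+1 (q * (1 - rho)) + #|L|%:R * (2 * x ^+ j.+1) / rho ^+ d.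
Proof.
move=> hq /andP[r0 r1] l1 lx x1.
have /andP[q0 q1] := hq.
have q01 : 0 <= q <= 1 by rewrite ltW.
have r01 : 0 <= 1 - rho <= 1 by lra.
have lqr : 0 <= 2 * lam / (q * (1 - rho)) by rewrite divr_ge0 ?mulr_ge0 ?subr_ge0 ?(ltW q0) ?(ltW r1) ?ler0n.
have x0 : 0 <= x by apply: le_trans lx.
pose stable s X W V := ((defect L X W == s) && (defect L X (W :&: V) == s))%:R : R.
apply: (@le_trans _ _ (\sum_(X in L) bin_exp q (fun W => bin_exp (1 - rho) (fun V =>
    (defect L X (W :&: V) - j.+1)%:R + \sum_(j.+1 <= s < n.+1) stable s X W V)))).
  apply: ler_sum => X XL; apply: le_bin_exp => // W.
  rewrite -[leLHS](bin_exp_const U (1 - rho)); apply: le_bin_exp => // V.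
  have hle : (defect L X W <= defect L X (W :&: V))%N.
    by apply: defect_anti; rewrite ?subsetIl.
  have hn : (defect L X W <= n)%N.
    by apply: leq_trans (L_card XL); apply: defect_le_card.
  have st0 s : 0 <= stable s X W V by apply: ler0n.
  move: hle; rewrite leq_eqVlt => /orP[/eqP e|hlt].
    have [hj|hj] := leqP (defect L X W) j.
      by rewrite (eqP hj) addr_ge0 ?ler0n ?sumr_ge0.
    rewrite (bigD1_seq (defect L X W)) ?mem_index_iota ?iota_uniq ?hj ?ltnS //=.
    have -> : stable (defect L X W) X W V = 1 by rewrite /stable -e eqxx.
    rewrite -e addrA natr1 -[leLHS]addr0 lerD ?sumr_ge0 //.
    by rewrite ler_nat subnS prednK ?subn_gt0.
  by rewrite -[leLHS]addr0 lerD ?sumr_ge0 // ler_nat -subSS leq_sub2r.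
apply: (@le_trans _ _ (\sum_(X in L) (bin_exp (q * (1 - rho)) (fun W => (defect L X W - j.+1)%:R)
   + \sum_(j.+1 <= s < n.+1) bin_exp q (fun W => bin_exp (1 - rho) (stable s X W))))).
  rewrite le_eqVlt; apply/orP; left; apply/eqP; apply: eq_bigr => X _.
  transitivity (bin_exp q (fun W =>
      bin_exp (1 - rho) (fun V => (defect L X (W :&: V) - j.+1)%:R)
      + \sum_(j.+1 <= s < n.+1) bin_exp (1 - rho) (stable s X W))).
    by apply: eq_bin_exp => W; rewrite bin_expD bin_exp_sum.
  rewrite bin_expD bin_exp_sum; congr (_ + _).
  exact: (bin_exp_thin q (1 - rho) (fun W => (defect L X W - j.+1)%:R)).
rewrite big_split /= lerD2l exchange_big /=.
apply: (@le_trans _ _ (\sum_(j.+1 <= s < n.+1) #|L|%:R * x ^+ s / rho ^+ d)).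
  apply: ler_sum => s _.
  apply: le_trans (stable_defect_prob s lam0 l1 L_spread L_shattered hq _) _; first by rewrite r0.
  rewrite ler_wpM2r ?invr_ge0 ?exprn_ge0 ?(ltW r0) // ler_wpM2l ?ler0n //.
  by rewrite lerXn2r ?nnegrE.
rewrite -mulr_suml -mulr_sumr ler_wpM2r ?invr_ge0 ?exprn_ge0 ?(ltW r0) //.
by rewrite ler_wpM2l ?ler0n // le_geometric_sum // x0.
Qed.

Lemma excess_chain (a : R) (k j : nat) :
  0 < a -> 2 * a <= 1 -> 32 * lam <= a -> (0 < k)%N ->
  (forall m, (k < m)%N -> (m ^ (2 * d) <= 2 ^ m)%N) ->
  (k <= j)%N -> excess j (a * (j.+1%:R / j%:R)) <= #|L|%:R * 2^-1 ^+ j.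
Proof.
move=> a0 a1 la k0 hk.
(* Downward induction on [j], with [i] bounding the distance to [n], where the excess vanishes. *)
suff H i : (n <= j + i)%N -> (k <= j)%N ->
    excess j (a * (j.+1%:R / j%:R)) <= #|L|%:R * 2^-1 ^+ j.
  by apply: (H n); rewrite leq_addl.
elim: i j => [|i IH] j hn hj.
  rewrite /excess big1 => [|X XL]; first by rewrite mulr_ge0 ?ler0n ?exprn_ge0 ?invr_ge0.
  rewrite /bin_exp big1 // => W _; rewrite (_ : (_ - _)%N = 0%N) ?mulr0 //.
  apply/eqP; rewrite subn_eq0; apply: leq_trans (defect_le_card _ XL) _.
  by apply: leq_trans (L_card XL) _; rewrite addn0 in hn.
have {}IH := IH j.+1; rewrite addSnnS hn (leq_trans hj) // in IH; have {}IH := IH isT isT.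
have y1 : 1 <= j%:R :> R by rewrite ler1n (leq_trans k0).
set y := j%:R in y1 *.
have e1 : j.+1%:R = y + 1 :> R by rewrite -natr1.
have e2 : j.+2%:R = y + 2 :> R by rewrite -natr1 e1 -addrA.
(* Then [1 - rho = y * (y + 2) / (y + 1) ^ 2], which takes the density at level [j] exactly to that
   at level [j.+1]; all densities stay between [a] and [2 * a]. *)
pose rho : R := (y + 1) ^- 2.
have y2 : 1 < (y + 1) ^+ 2 by rewrite expr2; nra.
have r01 : 0 < rho < 1 by rewrite invr_gt0 (lt_trans ltr01 y2) invf_lt1 // (lt_trans ltr01 y2).
have yn : (y + 1) / y = 1 + y^-1 by field; lra.
have iy : 0 < y^-1 <= 1 by rewrite invr_gt0 invf_le1; lra.
have q01 : 0 < a * ((y + 1) / y) <= 1 by rewrite yn; nra.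
have qr : a * ((y + 1) / y) * (1 - rho) = a * ((y + 2) / (y + 1)).
  by rewrite /rho; field; lra.
have qa : a <= a * ((y + 2) / (y + 1)).
  by rewrite ler_peMr ?(ltW a0) // ler_pdivlMr; lra.
have x1 : (16^-1 : R) <= 1 / 2 by lra.
have l1 : 2 * lam <= 1 by lra.
have lx : 2 * lam / (a * ((y + 1) / y) * (1 - rho)) <= 16^-1.
  by rewrite qr ler_pdivrMr; lra.
rewrite e1; apply: le_trans (excess_step j q01 r01 l1 lx x1) _.
rewrite qr; move: IH; rewrite e1 e2 => IH.
apply: le_trans (lerD IH _) _; first exact: lexx.
have rd : (rho ^+ d)^-1 <= 2 ^+ j.+1.
  rewrite /rho exprVn invrK -exprM -e1 -!natrX ler_nat.
  by apply: hk.
rewrite -mulrA -mulrDr ler_wpM2l ?ler0n //.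
(* The error is [2 * (2 / 16) ^ (j + 1)], which is [4 ^- (j + 1)] times [2 ^- j], hence at most a
   quarter of the target; the next level contributes half of it. *)
apply: (@le_trans _ _ (2^-1 ^+ j.+1 + 2 * 16^-1 ^+ j.+1 * 2 ^+ j.+1)).
  by rewrite lerD2l ler_wpM2l // mulr_ge0 // exprn_ge0 // invr_ge0.
rewrite -mulrA -exprMn.
have -> : 16^-1 * 2 = 2^-1 * 4^-1 :> R by field.
rewrite exprMn [2^-1 ^+ j.+1]exprS.
have h4 : 4^-1 ^+ j.+1 <= 4^-1 :> R.
  by rewrite exprS ler_piMr // ?exprn_ile1 //; lra.
have h2 : 0 <= 2^-1 ^+ j :> R by rewrite exprn_ge0 ?invr_ge0.
move: (4^-1 ^+ j.+1) (2^-1 ^+ j) h4 h2 => u v; nra.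
Qed.

(** The defect is at most [k] plus its part above [k], and the latter averages at most
    [2 ^- k <= 1]. *)
Lemma defect_mean (a : R) (k : nat) :
  0 < a -> 2 * a <= 1 -> 32 * lam <= a -> (0 < k)%N ->
  (forall m, (k < m)%N -> (m ^ (2 * d) <= 2 ^ m)%N) ->
  \sum_(X in L) bin_exp (a * (k.+1%:R / k%:R)) (fun W => (defect L X W)%:R)
  <= #|L|%:R * k.+1%:R.
Proof.
move=> a0 a1 la k0 hk; have := excess_chain a0 a1 la k0 hk (leqnn k).
set q := a * _ => hq.
have q01 : 0 <= q <= 1.
  have y1 : 1 <= k%:R :> R by rewrite ler1n.
  have iy : 0 < (k%:R : R)^-1 <= 1 by rewrite invr_gt0 invf_le1; lra.
  have yn : k.+1%:R / k%:R = 1 + k%:R^-1 :> R by rewrite -natr1 mulrDl divff ?mul1r //; lra.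
  by rewrite /q yn; nra.
apply: (@le_trans _ _ (#|L|%:R * k%:R + excess k q)).
  rewrite mulrC mulr_natr -sumr_const -big_split /=; apply: ler_sum => X XL.
  rewrite -{1}(bin_exp_const U q k%:R) -bin_expD; apply: le_bin_exp => // W.
  by rewrite -natrD ler_nat -leq_subLR.
rewrite -natr1 mulrDr lerD2l; apply: le_trans hq _.
by rewrite ler_wpM2l ?ler0n // exprn_ile1 //; lra.
Qed.

End Chain.

(** * Contracting the mean defect by augmentation *)

Section Halving.
Variables (R : realType) (U : finType) (L : {set {set U}}) (lam r : R) (n : nat).
Hypothesis lam0 : 0 <= lam.
Hypothesis L_spread : spread lam L.
Hypothesis L_card : forall X : {set U}, X \in L -> (#|X| <= n)%N.
Hypothesis r01 : 0 < r <= 1.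
Hypothesis lam_r : 64 * lam <= r.
Implicit Types (X Y W V T Z : {set U}).

(** The objective measures what is left after adding [V], while the bound on [Y :\: W] keeps the
    fragment inside a set no larger than the old defect, so that few fragments need to be
    enumerated. *)
Definition near_best X W V : {set U} :=
  [arg min_(Y < best L X W | [&& Y \in L, Y \subset X :|: W :|: V
     & (#|Y :\: W| <= defect L X W)%N]) #|Y :\: (W :|: V)|].

Definition near_defect X W V : nat := #|near_best X W V :\: (W :|: V)|.

Lemma near_bestP X W V : X \in L ->
  [/\ near_best X W V \in L, near_best X W V \subset X :|: W :|: V,
      (#|near_best X W V :\: W| <= defect L X W)%N &
      forall Y, Y \in L -> Y \subset X :|: W :|: V ->
        (#|Y :\: W| <= defect L X W)%N -> (near_defect X W V <= #|Y :\: (W :|: V)|)%N].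
Proof.
move=> XL; have [bL sb _] := bestP W XL; rewrite /near_defect /near_best.
case: arg_minnP => [|Y /and3P[YL sY cY] minY].
  by rewrite bL leqnn andbT /= (subset_trans sb) // subsetUl.
by split=> // Z ZL sZ cZ; apply: minY; rewrite ZL sZ.
Qed.

(** The choice is made from [W] and [Z] alone, without [X], so that fragments can be counted as its
    subsets. The value is [set0] when no member of [L] lies in [W :|: Z]. *)
Definition closest W Z : {set U} :=
  if [pick Y in L | Y \subset W :|: Z] is Some Y0 then
    [arg min_(Y < Y0 | (Y \in L) && (Y \subset W :|: Z)) #|Y :\: W|] :\: W
  else set0.

Lemma closestP W Z Y0 : Y0 \in L -> Y0 \subset W :|: Z ->
  exists Y, [/\ Y \in L, Y \subset W :|: Z, closest W Z = Y :\: W &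
    (#|Y :\: W| <= #|Y0 :\: W|)%N].
Proof.
move=> YL sY; rewrite /closest; case: pickP => [Y1 h1|/(_ Y0)]; last by rewrite YL sY.
case: arg_minnP => // Y /andP[? ?] minY; exists Y; split=> //.
by apply: minY; rewrite YL.
Qed.

(** The member picked by [closest] competes in [near_best], since it is no farther from [W] than the
    near-best one; by minimality its part outside [W :|: V] fills [T]. *)
Lemma near_defect_fragment X W V : X \in L ->
  exists T, [/\ #|T| = near_defect X W V, T \subset X, [disjoint V & T],
    T \subset closest W (V :|: T) & (#|closest W (V :|: T)| <= defect L X W)%N].
Proof.
move=> XL; have [bL sb cb minb] := near_bestP W V XL.
set B := near_best X W V in bL sb cb minb.
pose T := B :\: (W :|: V); exists T.
have sBT : B \subset W :|: (V :|: T) by rewrite setUA -subDset.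
have [Y [YL sY -> cY]] := closestP bL sBT.
have sTX : T \subset X by rewrite subDset setUC setUA.
have sYT : Y :\: (W :|: V) \subset T by rewrite subDset -setUA.
split=> //; last exact: leq_trans cY cb.
  by apply/pred0P=> x; rewrite /= !inE; case: (x \in V); rewrite ?orbT.
have <- : Y :\: (W :|: V) = T.
  apply/eqP; rewrite eqEcard sYT /= minb //; last exact: leq_trans cY cb.
  apply: subset_trans sY _; apply/subsetP=> x; rewrite !in_setU.
  by case/or3P=> [->|->|/(subsetP sTX)->]; rewrite ?orbT.
by rewrite setDS // subsetUl.
Qed.

(** On this event [closest] has fewer than [2 * s] points, hence at most [4 ^ s] subsets [T], each
    of degree at most [#|L| * lam ^ s]. *)
Lemma near_defect_prob W (s : nat) :
  \sum_(X in L) bin_exp r (fun V =>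
     ((near_defect X W V == s) && (defect L X W < 2 * s)%N)%:R)
  <= #|L|%:R * (4 * lam / r) ^+ s.
Proof.
have r01' : 0 <= r <= 1 by case/andP: r01 => /ltW -> ->.
pose w Z := ((#|closest W Z| < 2 * s)%N)%:R : R.
have w0 Z : 0 <= w Z by apply: ler0n.
apply: le_trans (_ : \sum_(X in L) bin_exp r (fun V => \sum_(T : {set U} |
     [&& #|T| == s, T \subset X, [disjoint V & T] & T \subset closest W (V :|: T)])
       w (V :|: T)) <= _).
  apply: ler_sum => X XL; apply: le_bin_exp => // V.
  case: andP => [[/eqP e1 hs]|_]; last by apply: sumr_ge0 => T _; apply: w0.
  have [T [cT sTX dT sT cc]] := near_defect_fragment W V XL.
  rewrite (bigD1 T) /=; last by rewrite cT e1 eqxx sTX dT sT.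
  by rewrite /w (leq_ltn_trans cc hs) lerDl sumr_ge0.
apply: le_trans (fragment_sum _ (closest W) s r01 w0) _.
have -> : #|L|%:R * (4 * lam / r) ^+ s = r ^- s * (#|L|%:R * (4 * lam) ^+ s).
  by rewrite exprMn exprVn mulrA mulrC.
rewrite ler_wpM2l ?invr_ge0 ?exprn_ge0 //; first by case/andP: r01'.
rewrite -(@bin_exp_const R U r (#|L|%:R * _)); apply: le_bin_exp => // Z.
rewrite /w; case: ltnP => hs; last by rewrite mul0r mulr_ge0 ?ler0n ?exprn_ge0 ?mulr_ge0.
rewrite mul1r.
apply: (@le_trans _ _ (\sum_(T in powerset (closest W Z)) #|L|%:R * lam ^+ s)).
  rewrite big_mkcondr /= (eq_bigl (mem (powerset (closest W Z)))); last first.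
    by move=> T; rewrite /= powersetE.
  apply: ler_sum => T _; case: eqP => [<-|_]; first exact: L_spread.
  by rewrite mulr_ge0 ?ler0n ?exprn_ge0.
rewrite sumr_const card_powerset -[leLHS]mulr_natr -mulrA ler_wpM2l ?ler0n //.
rewrite exprMn mulrC ler_wpM2r ?exprn_ge0 //.
rewrite -natrX ler_nat -[4%N]/(2 ^ 2)%N -expnM leq_exp2l //; exact: ltnW.
Qed.

(** Either the near-defect is at most half the old defect, or it is an [s] above half; the second
    case costs at most [#|L| / 4] on average. If [W] contains no member of [L], every defect is at
    least 1 and absorbs this cost; otherwise both sides vanish. *)
Lemma defect_halving W :
  \sum_(X in L) bin_exp r (fun V => (defect L X (W :|: V))%:R)
  <= 3 / 4 * \sum_(X in L) (defect L X W)%:R.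
Proof.
have r01' : 0 <= r <= 1 by case/andP: r01 => /ltW -> ->.
have [/existsP[Y /andP[YL sY]]|noY] := boolP [exists Y in L, Y \subset W].
  rewrite !big1 ?mulr0 // => X XL; first by rewrite (defect0 XL YL sY).
  rewrite /bin_exp big1 // => V _; rewrite (defect0 XL YL) ?mulr0 //.
  by rewrite (subset_trans sY) ?subsetUl.
have h1 X : X \in L -> 1 <= (defect L X W)%:R :> R.
  move=> XL; rewrite ler1n; apply: defect_gt0 => // Y YL.
  by apply: contra noY => sY; apply/existsP; exists Y; rewrite YL.
pose bad s X V := ((near_defect X W V == s) && (defect L X W < 2 * s)%N)%:R : R.
apply: (@le_trans _ _ (\sum_(X in L) bin_exp r (fun V => 2^-1 * (defect L X W)%:R
    + \sum_(1 <= s < n.+1) s%:R * bad s X V))).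
  apply: ler_sum => X XL; apply: le_bin_exp => // V.
  have [bL sb cb _] := near_bestP W V XL.
  have le1 : (defect L X (W :|: V) <= near_defect X W V)%N.
    by have [_ _ h] := bestP (W :|: V) XL; apply: h => //; rewrite setUA.
  have le2 : (near_defect X W V <= n)%N.
    apply: leq_trans (L_card XL); apply: leq_trans (defect_le_card W XL).
    by apply: leq_trans cb; rewrite subset_leq_card // setDS // subsetUl.
  apply: (@le_trans _ _ (near_defect X W V)%:R); first by rewrite ler_nat.
  have b0 s : 0 <= s%:R * bad s X V by rewrite mulr_ge0 ?ler0n.
  case: (leqP (2 * near_defect X W V) (defect L X W)) => hh.
    apply: (@le_trans _ _ (2^-1 * (defect L X W)%:R)); last first.
      by rewrite lerDl sumr_ge0.
    by rewrite ler_pdivlMl // -natrM ler_nat.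
  rewrite (bigD1_seq (near_defect X W V)) ?mem_index_iota ?iota_uniq ?ltnS ?le2 ?andbT //=; last first.
    by case: (near_defect X W V) hh.
  rewrite /bad eqxx hh mulr1 addrCA lerDl addr_ge0 ?mulr_ge0 ?invr_ge0 ?ler0n ?sumr_ge0 //.
apply: (@le_trans _ _ (\sum_(X in L) (2^-1 * (defect L X W)%:R)
   + \sum_(1 <= s < n.+1) s%:R * (#|L|%:R * (4 * lam / r) ^+ s))).
  rewrite (eq_bigr (fun X => 2^-1 * (defect L X W)%:R
     + \sum_(1 <= s < n.+1) s%:R * bin_exp r (bad s X))); last first.
    move=> X _; rewrite bin_expD bin_exp_const bin_exp_sum.
    by congr (_ + _); apply: eq_bigr => s _; rewrite bin_expZ.
  rewrite big_split lerD2l exchange_big /=; apply: ler_sum => s _.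
  by rewrite -mulr_sumr ler_wpM2l ?ler0n // near_defect_prob.
have hx : 4 * lam / r <= 16^-1 by case/andP: r01 => r0 _; rewrite ler_pdivrMr //; have := lam_r; lra.
have x0 : 0 <= 4 * lam / r by case/andP: r01' => r0 _; rewrite divr_ge0 ?mulr_ge0.
(* By [s <= 2 ^ s] and [4 * lam / r <= 1 / 16] the terms are at most [#|L| * 8 ^- s], and the series
   is at most twice its first term. *)
have tail : \sum_(1 <= s < n.+1) s%:R * (#|L|%:R * (4 * lam / r) ^+ s) <= #|L|%:R / 4.
  apply: (@le_trans _ _ (\sum_(1 <= s < n.+1) #|L|%:R * 8^-1 ^+ s)).
    apply: ler_sum => s _; rewrite mulrCA ler_wpM2l ?ler0n //.
    apply: (@le_trans _ _ (2 ^+ s * 16^-1 ^+ s)).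
      apply: ler_pM; rewrite ?ler0n ?exprn_ge0 //; last by rewrite lerXn2r ?nnegrE ?invr_ge0.
      by rewrite -natrX ler_nat ltnW // ltn_expl.
    by rewrite -exprMn (_ : 2 * 16^-1 = 8^-1) //; field.
  rewrite -mulr_sumr ler_wpM2l ?ler0n //.
  apply: le_trans (le_geometric_sum _ _ _) _; first by rewrite invr_ge0; lra.
  by rewrite expr1; lra.
have cL : #|L|%:R <= \sum_(X in L) (defect L X W)%:R :> R.
  by rewrite -sum1_card natr_sum; apply: ler_sum => X XL; apply: h1.
rewrite -mulr_sumr; move: tail cL.
set A := \sum_(1 <= s < n.+1) _; set B := \sum_(X in L) _; set N := #|L|%:R.
clearbody A B N; lra.
Qed.

End Halving.

(** * From spreadness to containment with high probability *)

Lemma spread_hitting (R : realType) (U : finType) (L : {set {set U}})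
    (lam p : R) (d n k J : nat) :
  0 <= lam -> spread lam L -> (forall D : {set U}, shattered L D -> (#|D| <= d)%N) ->
  (forall X : {set U}, X \in L -> (#|X| <= n)%N) -> (0 < #|L|)%N ->
  0 < p <= 1 -> (0 < k)%N -> (0 < J)%N ->
  (forall m, (k < m)%N -> (m ^ (2 * d) <= 2 ^ m)%N) ->
  128 * J%:R * lam <= p ->
  1 - (3 / 4) ^+ J * k.+1%:R <=
  bin_prob p (fun W : {set U} => [exists S in L, S \subset W]).
Proof.
move=> l0 hL hd hn L0 /andP[p0 p1] k0 J0 hk hJ.
have J1 : 1 <= J%:R :> R by rewrite ler1n.
(* The density [p] is split in half: thinning estimates need up to [2 * a = p / 2], and [J] rounds
   of augmentation by [r] share the rest. *)
pose a := p / 4; pose r := p / (2 * J%:R).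
have pl : 128 * lam <= p by apply: le_trans hJ; rewrite -mulrA ler_wpM2l // ler_peMl.
have r0 : 0 < r by rewrite divr_gt0 // mulr_gt0 // (lt_le_trans ltr01).
have rJ : r * J%:R = p / 2 by rewrite /r; field; lra.
have r1 : r <= 1 by nra.
have r64 : 64 * lam <= r.
  by rewrite ler_pdivlMr; [move: hJ; nra | lra].
pose mean q : R := bin_exp q (fun W => \sum_(X in L) (defect L X W)%:R).
pose q0 := a * (k.+1%:R / k%:R).
have k1 : 1 <= k%:R :> R by rewrite ler1n.
have ik : 0 < (k%:R : R)^-1 <= 1 by rewrite invr_gt0 invf_le1; lra.
have q0E : q0 = a * (1 + k%:R^-1).
  by rewrite /q0 -natr1 mulrDl divff ?mul1r //; lra.
have q0b : 0 <= q0 <= p / 2 by rewrite q0E /a; nra.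
have mean0 : mean q0 <= #|L|%:R * k.+1%:R.
  rewrite /mean bin_exp_sum; apply: (defect_mean l0 hL hd hn) => //; rewrite /a; lra.
have iter i : exists q, [/\ 0 <= q <= 1, q <= q0 + r * i%:R &
    mean q <= (3 / 4) ^+ i * (#|L|%:R * k.+1%:R)].
  elim: i => [|i [q [q01 qi hq]]].
    by exists q0; split; rewrite ?mulr0 ?addr0 ?expr0 ?mul1r //; lra.
  exists (q + r - q * r); split; first by apply/andP; split; nra.
    by rewrite -natr1 mulrDr mulr1; nra.
  rewrite exprS -mulrA; apply: le_trans (ler_wpM2l _ hq); last by lra.
  rewrite /mean -bin_exp_augment -bin_expZ; apply: le_bin_exp => // W.
  rewrite bin_exp_sum; apply: (defect_halving l0 hL hn) => //.
  by rewrite r0.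
have [q [q01 qJ hq]] := iter J.
have qp : 0 <= q <= p by case/andP: q01 => -> _; rewrite rJ in qJ; lra.
pose hit := fun W : {set U} => [exists S in L, S \subset W].
have -> : bin_prob p hit = 1 - bin_exp p (fun W => (~~ hit W)%:R).
  rewrite -[X in X - _](sum_bin_mass U p) /bin_exp -sumrB /bin_prob big_mkcond /=.
  by apply: eq_bigr => W _; case: (hit W); rewrite /= ?mulr0 ?subr0 ?mulr1 ?subrr.
rewrite lerD2l lerN2.
(* Missing every member is a decreasing event, so its probability at [p] is at most that at [q].
   There Markov's inequality applies: a miss makes all [#|L|] defects at least 1. *)
apply: (@le_trans _ _ (bin_exp q (fun W => (~~ hit W)%:R))).
  apply: bin_exp_antimono => // W V sVW; rewrite ler_nat.
  case: (boolP (hit W)) => //= nW; rewrite (_ : hit V = false) //.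
  apply/negbTE; apply: contra nW => /existsP[S /andP[SL sS]].
  by apply/existsP; exists S; rewrite SL (subset_trans sS).
have N0 : 0 < #|L|%:R :> R by rewrite ltr0n.
rewrite -(ler_pM2l N0); apply: le_trans (_ : mean q <= _); last first.
  by apply: le_trans hq _; rewrite mulrCA.
rewrite -bin_expZ; apply: le_bin_exp => // W.
case: (boolP (hit W)) => [_|nW]; first by rewrite mulr0 sumr_ge0.
rewrite mulr1 -sum1_card natr_sum; apply: ler_sum => X XL.
rewrite ler1n; apply: defect_gt0 => // Y YL; apply: contra nW => sY.
by apply/existsP; exists Y; rewrite YL.
Qed.

(** The inequality [ln y <= y - 1] at [y = 1 / x]. *)
Lemma ln_ge_three_quarters (R : realType) (x : R) : 4 <= x -> 3 / 4 <= ln x.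
Proof.
move=> x4; have x0 : 0 < x by lra.
have ix0 : 0 < x^-1 by rewrite invr_gt0.
have ix4 : x^-1 <= 4^-1 by rewrite lef_pV2 ?posrE //; lra.
have : ln (1 + (x^-1 - 1)) <= x^-1 - 1 by apply: le_ln1Dx; lra.
by rewrite addrC subrK lnV ?posrE //; lra.
Qed.

Lemma spread_robust (R : realType) (U : finType) (L : {set {set U}})
    (lam p eps : R) (d n : nat) :
  0 <= lam -> spread lam L -> (forall D : {set U}, shattered L D -> (#|D| <= d)%N) ->
  (forall X : {set U}, X \in L -> (#|X| <= n)%N) -> (0 < #|L|)%N -> (0 < d)%N ->
  0 < p <= 1 -> 0 < eps <= 1 / 2 ->
  4096 * ln (d.+1%:R / eps) * lam <= p ->
  1 - eps <= bin_prob p (fun W : {set U} => [exists S in L, S \subset W]).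
Proof.
move=> l0 hL hd hn L0 d0 hp /andP[e0 e1] hl.
have d2 : 2 <= d.+1%:R :> R by rewrite (ler_nat _ 2).
set D := d.+1%:R in d2 hl.
set Q := D / eps in hl.
have [Dpos eps1] : 0 < D /\ eps <= 1 by split; lra.
have Q4 : 4 <= Q by rewrite ler_pdivlMr //; lra.
have Q0 : 0 < Q by lra.
have lnQ : 3 / 4 <= ln Q by apply: ln_ge_three_quarters.
(* As [3 / 4 <= exp (- 1 / 4)], this many rounds give [(3 / 4) ^ J <= Q ^- 6]; the sixth power
   absorbs [k + 1 <= D ^ 6] and leaves [eps ^ 6]. *)
pose J := (Num.truncn (24 * ln Q)).+1.
have /andP[J1 J2] : (Num.truncn (24 * ln Q))%:R <= 24 * ln Q < J%:R.
  by apply: truncn_itv; lra.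
have Jle : J%:R <= 26 * ln Q by rewrite /J -natr1; lra.
pose k := (2 * d * (2 * d + 6))%N.
apply: le_trans (spread_hitting (k := k) (J := J) l0 hL hd hn L0 hp _ _ _ _) => //.
- rewrite lerD2l lerN2.
  have h34 : (3 / 4 : R) ^+ J <= (Q ^+ 6)^-1.
    apply: (@le_trans _ _ (expR (- (1 / 4)) ^+ J)).
      rewrite lerXn2r ?nnegrE ?expR_ge0 //; first by lra.
      by have := expR_ge1Dx (- (1 / 4) : R); lra.
    rewrite -expRM_natl -[Q in leRHS]lnK ?posrE // -expRM_natl -expRN ler_expR.
    lra.
  have kD : k.+1%:R <= D ^+ 6 by rewrite /D -natrX ler_nat /k; clear -d0; nia.
  have Q6 : (Q ^+ 6)^-1 = eps ^+ 6 / D ^+ 6 by rewrite /Q expr_div_n invf_div.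
  apply: (@le_trans _ _ ((Q ^+ 6)^-1 * D ^+ 6)).
    by apply: ler_pM; rewrite ?ler0n ?exprn_ge0 // divr_ge0.
  rewrite Q6 divfK ?expf_neq0 ?lt0r_neq0 //.
  by rewrite exprS ler_piMr ?exprn_ile1 // ltW.
- by rewrite /k muln_gt0 muln_gt0 d0 addn_gt0 orbT.
- by move=> m /ltnW; apply: expn_le_exp2.
(* Here [128 * 26 = 3328] is below 4096. *)
- by apply: le_trans hl; rewrite ler_wpM2r //; lra.
Qed.

Theorem corollary1p4 (R : realType) :
  exists2 C : R, 0 < C &
    forall (d n : nat) (p eps : R) (U : finType) (F : {set {set U}}),
      (1 <= d)%N -> (1 <= n)%N ->
      0 < p <= 1 -> 0 < eps <= 1 / 2 ->
      uniform n F -> (VC F <= d)%N ->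
      (C / p * ln (d.+1%:R / eps)) ^+ n < #|F|%:R ->
      exists2 G : {set {set U}}, G \subset F & robust_sunflower p eps G.
Proof.
exists 4096 => // d n p eps U F d0 n0 hp he hF hVC.
have /andP[p0 p1] := hp; have /andP[e0 e1] := he.
set ka := _ / p * _ => hcard.
have ln1 : 3 / 4 <= ln (d.+1%:R / eps).
  apply: ln_ge_three_quarters; rewrite ler_pdivlMr //.
  by have : 2 <= d.+1%:R :> R; [rewrite (ler_nat _ 2) | lra].
have ka1 : 1 <= ka.
  by rewrite /ka mulrAC ler_pdivlMr // mul1r; lra.
have ka0 : 0 < ka by lra.
pose link (T : {set U}) := [set S in F | T \subset S].
(* The link has more than [ka ^ (n - #|T|)] members, written without truncated subtraction. *)
pose heavy (T : {set U}) := ka ^+ n < #|link T|%:R * ka ^+ #|T|.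
have heavy0 : heavy set0.
  rewrite /heavy cards0 expr0 mulr1 (_ : link set0 = F) //.
  by apply/setP=> S; rewrite inE sub0set andbT.
have [T hT maxT] := @arg_maxnP _ set0 heavy (fun T => #|T|) heavy0.
have link_card T' : heavy T' -> (0 < #|link T'|)%N.
  rewrite /heavy; case: #|_| => //; rewrite mul0r ltNge exprn_ge0 //; exact: ltW.
have [S0 hS0] : exists S, S \in link T by apply/set0Pn; rewrite -card_gt0 link_card.
have Tn : (#|T| <= n)%N.
  by move: hS0; rewrite inE => /andP[S0F /subset_leq_card]; rewrite (hF _ S0F).
have hT' : ka ^+ (n - #|T|) < #|link T|%:R.
  by rewrite -(ltr_pM2r (exprn_gt0 #|T| ka0)) -exprD subnK.
(* A heavy [T] of size [n] would have more than one member in its link, while only [T] itself can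
   belong to it. *)
have Tlt : (#|T| < n)%N.
  rewrite ltn_neqAle Tn andbT; apply/negP=> /eqP e.
  move: hT'; rewrite e subnn expr0 (_ : #|link T| = 1%N) ?ltxx //.
  apply/eqP/cards1P; exists T; apply/setP=> S; rewrite !inE.
  apply/andP/eqP => [[SF sT]|->].
    by apply/esym/eqP; rewrite eqEcard sT (hF _ SF) e leqnn.
  move: hS0; rewrite inE => /andP[S0F sT]; split=> //.
  suff -> : T = S0 by [].
  by apply/eqP; rewrite eqEcard sT (hF _ S0F) e leqnn.
have light (T' : {set U}) : (#|T| < #|T'|)%N -> #|link T'|%:R * ka ^+ #|T'| <= ka ^+ n.
  by move=> h; rewrite leNgt; apply: contraL h => /maxT; rewrite -leqNgt.
have card2 : (2 <= #|link T|)%N.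
  by rewrite -(ltr_nat R); apply: le_lt_trans hT'; rewrite exprn_ege1.
have kerT : kernel (link T) = T.
  apply/eqP; rewrite eqEsubset; apply/andP; split; last first.
    by apply/bigcapsP=> S; rewrite inE => /andP[].
  (* A further common point [x] would leave the link unchanged, so [x |: T] would be heavy because
     [ka >= 1], against maximality. *)
  apply/subsetP=> x /bigcapP xk; apply/negPn/negP=> xT.
  have := light (x |: T); rewrite cardsU1 xT add1n => /(_ (leqnn _)).
  have -> : link (x |: T) = link T.
    apply/setP=> S; rewrite !inE subUset sub1set.
    by apply/idP/idP => [/and3P[-> _ ->] //|h]; rewrite xk ?inE //.
  rewrite leNgt => /negP; apply; apply: lt_le_trans hT _.
  by rewrite exprS mulrCA ler_peMl // mulr_ge0 ?ler0n // exprn_ge0 // ltW.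
exists (link T); first by apply/subsetP=> S; rewrite inE => /andP[].
split=> //; rewrite kerT.
  by apply/negP; rewrite inE => /andP[TF _]; move: Tlt; rewrite (hF _ TF) ltnn.
pose L := [set S :\: T | S in link T].
have injT : {in link T &, injective (fun S => S :\: T)}.
  move=> S S'; rewrite !inE => /andP[_ sS] /andP[_ sS'] e.
  by rewrite -(setID S T) -(setID S' T) (setIidPr sS) (setIidPr sS') e.
have cL : #|L| = #|link T| by apply: card_in_imset.
have L0 : (0 < #|L|)%N by rewrite cL; apply: leq_trans card2.
(* A [Z] meeting [T] lies in no member of [L]. A nonempty [Z] disjoint from [T] makes [T :|: Z]
   larger than [T], hence light; comparison with the heavy [T] gives the factor [ka ^- #|Z|]. *)
have hL : spread ka^-1 L.
  move=> Z; have [/eqP ->|dZ] := boolP (Z == set0).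
    rewrite cards0 expr0 mulr1 ler_nat subset_leq_card //.
    by apply/subsetP=> S; rewrite inE => /andP[].
  have sLZ : [set X in L | Z \subset X] \subset [set S :\: T | S in link (T :|: Z)].
    apply/subsetP=> _ /setIdP[/imsetP[S + ->] sZ]; rewrite inE => /andP[SF sT].
    apply/imsetP; exists S => //; rewrite inE SF subUset sT /=.
    exact: subset_trans sZ (subsetDl _ _).
  have [dTZ|] := boolP [disjoint T & Z]; last first.
    move/pred0Pn=> [x /= /andP[xT xZ]].
    rewrite (_ : [set X in L | Z \subset X] = set0); last first.
      apply/setP=> X; rewrite in_set0; apply/negP=> /setIdP[/imsetP[S _ ->]].
      by move/subsetP/(_ x xZ); rewrite inE xT.
    by rewrite cards0 mulr_ge0 ?ler0n // exprn_ge0 // invr_ge0 ltW.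
  have cTZ : #|T :|: Z| = (#|T| + #|Z|)%N by apply/eqP; rewrite (leq_card_setU T Z).
  apply: (@le_trans _ _ #|link (T :|: Z)|%:R).
    by rewrite ler_nat (leq_trans (subset_leq_card sLZ)) ?leq_imset_card.
  have := light (T :|: Z); rewrite cTZ -addn1 leq_add2l card_gt0 dZ => /(_ isT) h.
  rewrite exprVn ler_pdivlMr ?exprn_gt0 // cL -(ler_pM2r (exprn_gt0 #|T| ka0)).
  by rewrite -mulrA -exprD addnC; apply: le_trans h (ltW hT).
(* A set shattered by [L] avoids [T], and off [T] the sets [S] and [S :\: T] have the same trace, so
   [F] shatters it too. *)
have hd (D : {set U}) : shattered L D -> (#|D| <= d)%N.
  move/shatteredP=> h; apply: leq_trans hVC.
  have dDT x : x \in D -> x \notin T.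
    have [_ /imsetP[S _ ->] e] := h D (subxx D).
    by rewrite -e !inE => /andP[/andP[]].
  apply: leq_bigmax_cond; apply/shatteredP=> B /h[_ /imsetP[S + ->] <-].
  rewrite inE => /andP[SF _]; exists S => //; apply/setP=> x; rewrite !inE.
  by case: (boolP (x \in D)) => [/dDT ->|]; rewrite ?andbF.
have hn (X : {set U}) : X \in L -> (#|X| <= n)%N.
  case/imsetP=> S; rewrite inE => /andP[SF _] ->.
  by rewrite -(hF _ SF) subset_leq_card // subsetDl.
have := @spread_robust R U L ka^-1 p eps d n; rewrite invr_ge0 (ltW ka0).
move=> /(_ isT hL hd hn L0 d0 hp he) h; apply: le_trans (h _) _.
  have ln0 : ln (d.+1%:R / eps) != 0 by rewrite gt_eqF // (lt_le_trans _ ln1) // divr_gt0.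
  (* The choice of [ka] makes the required inequality an equality. *)
  by rewrite /ka le_eqVlt; apply/orP; left; apply/eqP; field; rewrite ln0 gt_eqF.
rewrite le_eqVlt; apply/orP; left; apply/eqP; apply: eq_bigl => W.
apply/existsP/existsP => [[_ /andP[/imsetP[S SF ->] sW]]|[S /andP[SF sW]]].
  by exists S; rewrite SF -subDset.
exists (S :\: T); apply/andP; split; last by rewrite subDset.
exact: imset_f.
Qed.
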